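(* Let $x>0$. Then for any $\lambda\in\Lambda(x)$ and any $\delta\in(0,\lambda)$, $$\dim_{\mathrm H}\bigl(\Lambda(x)\cap(\lambda-\delta,\lambda+\delta)\bigr)=\dim_{\mathrm H}E_\lambda=\frac{\log 2}{\log 3}.$$
   Context: For $\lambda>0$, $E_\lambda$ denotes the self-similar set generated by the iterated function system $\{f_0(t)=t/3,\ f_1(t)=(t+\lambda)/3\}$ on $\mathbb{R}$; equivalently $E_\lambda=\left\{\sum_{i=1}^\infty d_i/3^i : d_i\in\{0,\lambda\}\right\}=\frac{\lambda}{2}C_{1/3}$, where $C_{1/3}$ is the middle-third Cantor set. For $x>0$, $\Lambda(x)=\{\lambda>0 : x\in E_\lambda\}$. $\dim_{\mathrm H}$ denotes Hausdorff dimension. *)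

(* Defs.v *)
From HB Require Import structures.
From mathcomp Require Import all_boot all_order all_algebra.
From mathcomp Require Import all_classical all_reals all_analysis.
From mathcomp Require Import ring lra.

Set Implicit Arguments.
Unset Strict Implicit.
Unset Printing Implicit Defensive.

Import Order.TTheory GRing.Theory Num.Theory.
Import numFieldNormedType.Exports.

Local Open Scope classical_set_scope.
Local Open Scope ring_scope.

Section HausdorffDimension.
Context {R : realType}.
Implicit Types (A U : set R) (s delta : R).

(* [diam set0 = -oo] since [ereal_sup set0 = -oo]. *)
Definition diam U : \bar R :=
  ereal_sup [set r | exists y z, [/\ U y, U z & r = `|y - z|%:E]].

(* |U|^s with the usual conventions |set0|^s = 0 for all s >= 0 (including
   s = 0) and |U|^0 = 1 for nonempty U. *)
Definition diam_pow s U : \bar R :=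
  if U == set0 then 0%E else poweR (diam U) s.

Definition hausdorff_pre s delta A : \bar R :=
  ereal_inf [set r | exists U : nat -> set R,
    [/\ A `<=` \bigcup_k U k,
        (forall k, (diam (U k) <= delta%:E)%E) &
        r = (\sum_(0 <= k <oo) diam_pow s (U k))%E]].

(* The limit as delta tends to 0, which is a supremum because
   [hausdorff_pre s delta A] is nonincreasing in delta. *)
Definition hausdorff_measure s A : \bar R :=
  ereal_sup [set hausdorff_pre s delta A | delta in [set delta | 0 < delta]].

Definition hausdorff_dim A : \bar R :=
  ereal_inf [set s%:E | s in [set s | 0 <= s /\ hausdorff_measure s A = 0%E]].

End HausdorffDimension.

Section SelfSimilarSets.
Context {R : realType}.

Definition self_similar (I : Type) (f : I -> R -> R) (K : set R) : Prop :=
  [/\ K !=set0, compact K & K = \bigcup_i (f i @` K)].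

(* Meaningful for finitely many contractions f, where exactly one K is
   self-similar (otherwise it may be set0 or an arbitrary choice); for [ifs lam] see
   [Elam_self_similar] (existence) and [self_similar_digits] (uniqueness). *)
Definition self_similar_set (I : Type) (f : I -> R -> R) : set R :=
  xget set0 (self_similar f).

Definition ifs (lam : R) (b : bool) (t : R) : R :=
  if b then (t + lam) / 3 else t / 3.

Definition Elam (lam : R) : set R := self_similar_set (ifs lam).

Definition Lambda (x : R) : set R := [set lam | 0 < lam /\ Elam lam x].

(* Explicit description of [Elam] as a set of ternary expansions with digits in
   {0, lam}; digits are indexed from 0, hence the exponent i.+1. *)
Definition digit_sums (lam : R) : set R :=
  [set t | exists d : nat -> bool,
    series (fun i => (if d i then lam else 0) / 3 ^+ i.+1) @ \oo --> t].

Let psum (lam : R) (d : nat -> bool) : nat -> R :=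
  series (fun i => (if d i then lam else 0) / 3 ^+ i.+1).

Let S_S lam d n : psum lam d n.+1 = psum lam d n + (if d n then lam else 0) / 3 ^+ n.+1.
Proof. by rewrite /psum /series /= big_nat_recr. Qed.

Let S_shift lam d n :
  psum lam d n.+1 = ifs lam (d 0%N) (psum lam (fun i => d i.+1) n).
Proof.
elim: n => [|n IH].
  by rewrite S_S /psum /series /= !big_geq // /ifs; case: (d 0%N); rewrite ?expr1 !add0r.
rewrite S_S IH S_S /ifs exprS invfM.
by case: (d 0%N); case: (d n.+1); field.
Qed.

Let ifs_cont lam b : continuous (ifs lam b).
Proof.
case: b => t; rewrite /ifs; apply: cvgM; try exact: cvg_cst; last exact: cvg_id.
by apply: cvgD; [exact: cvg_id | exact: cvg_cst].
Qed.

Let small (M : R) (u : nat -> R) :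
  (forall n, `|u n| <= M) -> (fun n => u n / 3 ^+ n) @ \oo --> (0 : R).
Proof.
move=> uM; apply/norm_cvg0P.
apply: (@squeeze_cvgr _ _ _ _ (fun=> 0) (geometric M 3^-1)).
- apply: nearW => n; rewrite normr_ge0 /= normrM normfV normrX.
  rewrite (@ger0_norm _ 3) // /geometric /= exprVn ler_wpM2r //.
- exact: cvg_cst.
- apply: cvg_geometric; rewrite ger0_norm; lra.
Qed.

Lemma self_similar_digits (lam : R) (K : set R) :
  self_similar (ifs lam) K -> K = digit_sums lam.
Proof.
move=> [[k0 Kk0] Kcpt KE].
have [M KM] : exists M, forall y, K y -> `|y| <= M.
  have [M [_ HM]] := compact_bounded Kcpt.
  exists (M + 1) => y Ky; apply: (HM (M + 1)) => //; lra.
have KV b y : K y -> K (ifs lam b y) by move=> Ky; rewrite KE; exists b => //; exists y.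
apply/seteqP; split => x.
- move=> Kx.
  have /choice[c Hc] : forall y, exists p : bool * R,
      K y -> K p.2 /\ y = ifs lam p.1 p.2.
    move=> y; have [Ky|nK] := pselect (K y); last by exists (true, 0).
    by move: (Ky); rewrite {1}KE => -[b _ [z Kz <-]]; exists (b, z).
  pose o n := iter n (fun y => (c y).2) x.
  have Ko n : K (o n) by elim: n => //= n IH; have [] := Hc _ IH.
  pose d n := (c (o n)).1.
  exists d; rewrite -/(psum lam d).
  have SE n : psum lam d n = x - o n / 3 ^+ n.
    elim: n => [|n IH]; first by rewrite /psum /series /= big_geq // expr0 divr1 subrr.
    rewrite S_S IH; have [_ {1}->] := Hc _ (Ko n).
    have n3 : (3 : R) ^+ n != 0 by rewrite expf_neq0.
    by rewrite exprS /ifs -/(d n) /=; case: (d n); field.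
  rewrite (_ : psum lam d = fun n => x - o n / 3 ^+ n); last exact/funext.
  rewrite -[X in _ --> X]subr0.
  by apply: cvgB; [exact: cvg_cst | apply: (@small M) => n; exact/KM/Ko].
- move=> [d]; rewrite -/(psum lam d) => Sx.
  have KS n : forall k, K k -> K (psum lam d n + k / 3 ^+ n).
    elim: n => [|n IH] k Kk.
      by rewrite /psum /series /= big_geq // expr0 divr1 add0r.
    have := IH _ (KV (d n) _ Kk); rewrite S_S; congr (K _).
    have n3 : (3 : R) ^+ n != 0 by rewrite expf_neq0.
    by rewrite exprS /ifs; case: (d n); field.
  have Kcl : closed K by apply: compact_closed => //; exact: Rhausdorff.
  apply: (@closed_cvg _ _ \oo _ (fun n => psum lam d n + k0 / 3 ^+ n) K) => //.
    by apply: nearW => n; exact: KS.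
  rewrite -[X in _ --> X]addr0.
  by apply: cvgD; [exact: Sx | apply: (@small M) => n; exact: KM].
Qed.

Let digits_ifs lam b y : digit_sums lam y -> digit_sums lam (ifs lam b y).
Proof.
move=> [d dy]; pose e i := if i is j.+1 then d j else b.
exists e; rewrite -/(psum lam e) -(cvg_shiftS (psum lam e)).
rewrite (_ : [sequence _]_n = fun n => ifs lam b (psum lam d n)).
  exact: (cvg_comp _ _ dy (@ifs_cont lam b y)).
by apply/funext => n /=; rewrite S_shift.
Qed.

Let digits_ifs_inv lam x :
  digit_sums lam x -> exists b y, digit_sums lam y /\ x = ifs lam b y.
Proof.
move=> [d dx]; exists (d 0%N), (3 * x - if d 0%N then lam else 0); split.
- exists (fun i => d i.+1); rewrite -/(psum lam _).
  rewrite (_ : psum lam _ = fun n => 3 * psum lam d n.+1 - if d 0%N then lam else 0).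
    apply: cvgB; last exact: cvg_cst.
    apply: cvgM; first exact: cvg_cst.
    by rewrite (cvg_shiftS (psum lam d)).
  by apply/funext => n; rewrite S_shift /ifs; case: (d 0%N); field.
- by rewrite /ifs; case: (d 0%N); field.
Qed.

Lemma digit_sums_self_similar (lam : R) :
  self_similar (ifs lam) (digit_sums lam).
Proof.
suff ss : self_similar (ifs lam) (closure (digit_sums lam)).
  by rewrite -(self_similar_digits ss).
have D0 : digit_sums lam 0.
  exists (fun=> false); rewrite (_ : series _ = fun=> 0); first exact: cvg_cst.
  by apply/funext => n; rewrite /series /= big1 // => i _; rewrite mul0r.
have clcpt : compact (closure (digit_sums lam)).
  apply: (subclosed_compact (@closed_closure _ _) (@segment_compact _ (- `|lam|) `|lam|)).
  rewrite [X in _ `<=` X](closure_id _).1; last exact: itv_closed.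
  apply: closure_subset => x [d]; rewrite -/(psum lam d) => dx.
  apply: (@closed_cvg _ _ \oo _ (psum lam d)); [exact: itv_closed| |exact: dx].
  apply: nearW => n /=; rewrite in_itv /= -ler_norml {dx x D0}.
  elim: n d => [|n IH] d; first by rewrite /psum /series /= big_geq // normr0.
  rewrite S_shift /ifs; move: (IH (fun i => d i.+1)); rewrite !ler_norml.
  have := normr_ge0 lam; have := ler_norm lam; have := ler_norm (- lam).
  rewrite normrN; set s := psum _ _ _.
  by case: (d 0%N) => ? ? ? /andP[? ?]; apply/andP; split; lra.
split => //; first by exists 0; exact: subset_closure.
apply/seteqP; split.
- set F := \bigcup_i _.
  have Fcl : closed F.
    rewrite /F (_ : \bigcup_i _ = ifs lam true @` closure (digit_sums lam)
                 `|` ifs lam false @` closure (digit_sums lam)); last first.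
      apply/seteqP; split=> [z [[] _ zz]|z [zz|zz]]; [by left|by right| |].
      + by exists true.
      + by exists false.
    apply: closedU; apply: compact_closed => //; try exact: Rhausdorff;
      by apply: continuous_compact => //; apply: continuous_subspaceT; exact: ifs_cont.
  rewrite [F](closure_id _).1 //; apply: closure_subset => x.
  move=> /digits_ifs_inv[b [y [Dy ->]]]; exists b => //; exists y => //.
  exact: subset_closure.
- move=> _ [b _ [y cy <-]] B /(@ifs_cont lam b y) /cy[z [Dz Bz]].
  by exists (ifs lam b z); split=> //; exact: digits_ifs.
Qed.

Lemma Elam_self_similar (lam : R) : self_similar (ifs lam) (Elam lam).
Proof. exact: (xgetPex set0 (ex_intro _ _ (digit_sums_self_similar lam))). Qed.

Lemma Elam_digits (lam : R) : Elam lam = digit_sums lam.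
Proof. exact: self_similar_digits (Elam_self_similar lam). Qed.

End SelfSimilarSets.

(* Main.v *)
(* Points of the Cantor set are coded by binary sequences d through
   dsum 3 d = \sum_i d_i / 3^(i+1), and Lambda x consists of the quotients
   x / dsum 3 d, so near lam it is a bi-Lipschitz image of a piece of the Cantor
   set. Both dimensions thus follow from estimates on a coding map P.
   Upper bound: the 2^n cylinders of length n have diameter O(3^-n).
   Lower bound: if sequences first differing at n have images at distance at
   least c / 3^n, then P d |-> dsum 2 d (the Cantor function) is Hoelder of
   exponent ln 2 / ln 3 and maps onto [0, 1]; a cover of the set therefore yields
   a cover of [0, 1] by intervals, whose total length is at least 1. *)
Require Import Defs.
From HB Require Import structures.
From mathcomp Require Import all_boot all_order all_algebra.
From mathcomp Require Import all_classical all_reals all_analysis.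
From mathcomp Require Import ring lra zify.

Set Implicit Arguments.
Unset Strict Implicit.
Unset Printing Implicit Defensive.

Import Order.TTheory GRing.Theory Num.Theory.
Import numFieldNormedType.Exports.

Local Open Scope classical_set_scope.
Local Open Scope ring_scope.

(** * Binary digit sums in base [b]: bounds, dependence on prefixes, binary expansions *)

Section DigitSums.
Context {R : realType}.
Implicit Types (b y : R) (d e : nat -> bool) (n : nat).

Definition dsum b d : R := limn (series (fun i => (d i)%:R / b ^+ i.+1)).

Lemma cvg_dsum b d : 1 < b ->
  series (fun i => (d i)%:R / b ^+ i.+1) @ \oo --> dsum b d.
Proof.
move=> b1; have b0 : 0 < b by lra.
suff : cvgn (series (fun i => (d i)%:R / b ^+ i.+1)) by [].
apply: (@series_le_cvg _ _ (geometric b^-1 b^-1)) => [i|i|i|].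
- by rewrite divr_ge0 // exprn_ge0 // ltW.
- by rewrite /geometric /= mulr_ge0 ?exprn_ge0 // invr_ge0 ltW.
- rewrite /geometric /= -exprS exprVn ler_piMl ?invr_ge0 ?exprn_ge0 ?(ltW b0) //.
  by case: (d i).
- apply: is_cvg_geometric_series; rewrite ger0_norm ?invr_ge0 ?(ltW b0) //.
  by rewrite invf_lt1.
Qed.

Lemma dsumS b d : 1 < b ->
  dsum b d = ((d 0%N)%:R + dsum b (fun i => d i.+1)) / b.
Proof.
move=> b1; have b0 : b != 0 by rewrite gt_eqF //; lra.
apply: cvg_lim => //; rewrite -cvg_shiftS.
rewrite (_ : [sequence _]_n = fun n => ((d 0%N)%:R +
    series (fun i => (d i.+1)%:R / b ^+ i.+1) n) / b).
  apply: cvgM; last exact: cvg_cst.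
  by apply: cvgD; [exact: cvg_cst | exact: cvg_dsum].
apply/funext => n /=; rewrite /series /= big_nat_recl //= expr1 mulrDl; congr (_ + _).
rewrite mulr_suml; apply: eq_bigr => i _.
by rewrite [b ^+ i.+2]exprSr invfM mulrA.
Qed.

Lemma dsum_ge0 b d : 1 < b -> 0 <= dsum b d.
Proof.
move=> b1; apply: limr_ge; first by apply/cvg_ex; exists (dsum b d); exact: cvg_dsum.
apply: nearW => n; apply: sumr_ge0 => i _.
by rewrite divr_ge0 // exprn_ge0 //; lra.
Qed.

Lemma dsum_le b d : 1 < b -> dsum b d <= (b - 1)^-1.
Proof.
move=> b1; have b0 : 0 < b by lra.
apply: limr_le; first by apply/cvg_ex; exists (dsum b d); exact: cvg_dsum.
apply: nearW => n.
(* The right-hand side is the partial sum with all digits 1; its deficit [b ^- n] is what makes the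
   induction close. *)
suff : series (fun i => (d i)%:R / b ^+ i.+1) n <= (b - 1)^-1 * (1 - b ^- n).
  move=> /le_trans; apply; rewrite ler_piMr ?invr_ge0 ?subr_ge0 ?(ltW b1) //.
  by rewrite gerBl invr_ge0 exprn_ge0 // ltW.
elim: n => [|n IH]; first by rewrite /series /= big_geq // expr0 invr1 subrr mulr0.
rewrite /series /= big_nat_recr //=; apply: le_trans (lerD IH (_ : _ <= b ^- n.+1)) _.
  by rewrite ler_piMl ?invr_ge0 ?exprn_ge0 ?(ltW b0) //; case: (d n).
rewrite le_eqVlt; apply/orP; left; apply/eqP; rewrite exprS.
have bn0 : b ^+ n != 0 by rewrite expf_neq0 // gt_eqF.
have b10 : b - 1 != 0 by rewrite gt_eqF // subr_gt0.
by field; rewrite bn0 b10 gt_eqF.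
Qed.

Lemma dsum_prefix b d e n : 1 < b -> (forall i, (i < n)%N -> d i = e i) ->
  dsum b d - dsum b e =
  (dsum b (fun i => d (n + i)%N) - dsum b (fun i => e (n + i)%N)) / b ^+ n.
Proof.
move=> b1; elim: n d e => [|n IH] d e de.
  by rewrite expr0 divr1; congr (dsum _ _ - dsum _ _); apply/funext.
rewrite (dsumS d) // (dsumS e) // (de 0%N) // -mulrBl addrAC opprD addrA subrr add0r.
rewrite addrC (IH (fun i => d i.+1) (fun i => e i.+1)); last by move=> i; exact: (de i.+1).
by rewrite exprSr invfM mulrA; congr (_ / _); rewrite mulrC.
Qed.

Lemma dsum_prefix_le b d e n : 1 < b -> (forall i, (i < n)%N -> d i = e i) ->
  `|dsum b d - dsum b e| <= (b - 1)^-1 / b ^+ n.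
Proof.
move=> b1 de; have b0 : 0 <= b by lra.
rewrite (dsum_prefix b1 de) normrM normfV [`|b ^+ n|]ger0_norm ?exprn_ge0 //.
rewrite ler_wpM2r ?invr_ge0 ?exprn_ge0 //.
have := dsum_ge0 (fun i => d (n + i)%N) b1; have := dsum_ge0 (fun i => e (n + i)%N) b1.
have := dsum_le (fun i => d (n + i)%N) b1; have := dsum_le (fun i => e (n + i)%N) b1.
by rewrite ler_norml => *; apply/andP; split; lra.
Qed.

Lemma dsum3_le d : dsum 3 d <= 1 / 2.
Proof.
have -> : 1 / 2 = (3 - 1)^-1 :> R by rewrite mul1r; congr _^-1; lra.
by apply: dsum_le; lra.
Qed.

(** Once the common prefix is scaled away, the difference is [(1 + u - v) / 3] up to sign, with
    tails [u], [v] in [0, 1/2]; hence it is at least (1 - 1/2) / 3 = 1/6. In base 2 the tails reach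
    1 and no such gap exists. *)
Lemma dsum3_prefix_ge d e n : (forall i, (i < n)%N -> d i = e i) -> d n != e n ->
  6^-1 / 3 ^+ n <= `|dsum 3 d - dsum 3 e|.
Proof.
have b1 : 1 < 3 :> R by lra.
move=> de; rewrite (dsum_prefix b1 de) normrM normfV [`|3 ^+ n|]ger0_norm ?exprn_ge0 //.
move=> dne; rewrite ler_wpM2r ?invr_ge0 ?exprn_ge0 //.
rewrite (dsumS (fun i => d _)) // (dsumS (fun i => e _)) // addn0.
set u := dsum _ _; set v := dsum _ _.
have u0 : 0 <= u by exact: dsum_ge0.
have v0 : 0 <= v by exact: dsum_ge0.
have u1 : u <= 1 / 2 by exact: dsum3_le.
have v1 : v <= 1 / 2 by exact: dsum3_le.
rewrite ler_normr; apply/orP.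
by case: (d n) (e n) dne => -[] //= _; [left|right]; lra.
Qed.

Lemma dsum2_surj y : 0 <= y <= 1 -> exists d, y = dsum 2 d.
Proof.
(* [f] is the doubling map and [o n] the remainder after [n] digits. The point 1 is fixed by [f], so
   [y = 1] receives the expansion with all digits 1. *)
move=> y01; pose f (z : R) := 2 * z - (1 / 2 <= z)%R%:R; pose o n := iter n f y.
have o01 n : 0 <= o n <= 1.
  elim: n => //= n; rewrite -/(o n) /f; move: (o n) => z /andP[z0 z1].
  by case: (lerP (1 / 2) z) => /= ?; apply/andP; split; lra.
exists (fun n => 1 / 2 <= o n); apply/esym/cvg_lim => //.
rewrite (_ : series _ = fun n => y - o n / 2 ^+ n); last first.
  apply/funext; elim=> [|n IH]; first by rewrite /series /= big_geq // expr0 divr1 subrr.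
  rewrite /series /= big_nat_recr //= [X in X + _]IH -/(o n) /f exprS.
  have : (2 : R) ^+ n != 0 by rewrite expf_neq0.
  by move=> ?; field.
rewrite -[X in _ --> X]subr0; apply: cvgB; first exact: cvg_cst.
apply: (@squeeze_cvgr _ _ _ _ (fun=> 0) (geometric 1 2^-1)).
- apply: nearW => n; have /andP[ on0 on1] := o01 n.
  rewrite divr_ge0 ?exprn_ge0 //= /geometric /= exprVn.
  by rewrite ler_wpM2r // invr_ge0 exprn_ge0.
- exact: cvg_cst.
- by apply: cvg_geometric; rewrite ger0_norm; lra.
Qed.

End DigitSums.

(** * Numbering of the cylinders of length [n] *)

Section PrefixCode.
Implicit Types (d e : nat -> bool) (n : nat).

(** Covers are indexed by [nat], so a cylinder is named by its prefix read as a binary number, last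
    digit least significant; parity then recovers that digit. *)
Fixpoint prefix_code d n : nat :=
  if n is m.+1 then (d m + (prefix_code d m).*2)%N else 0%N.

Lemma prefix_code_lt d n : (prefix_code d n < 2 ^ n)%N.
Proof. by elim: n => //= n IH; rewrite expnS; case: (d n) => /=; lia. Qed.

Lemma prefix_code_inj d e n : prefix_code d n = prefix_code e n ->
  forall i, (i < n)%N -> d i = e i.
Proof.
elim: n => //= n IH de i; have dne : d n = e n.
  by have /(congr1 odd) := de; rewrite !oddD !odd_double !addbF !oddb.
rewrite ltnS leq_eqVlt => /predU1P[->//|]; apply: IH.
by apply: double_inj; apply/eqP; rewrite -(eqn_add2l (d n)) {2}dne de.
Qed.

End PrefixCode.

(** * Dimension bounds from a coding map *)

Section DimensionBounds.
Context {R : realType}.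
Implicit Types (A U : set R) (P : (nat -> bool) -> R) (s t delta : R).

Local Notation s0 := (ln 2 / ln 3 : R).

Let ln3_gt0 : 0 < ln 3 :> R.
Proof. by apply: ln_gt0; lra. Qed.

Lemma powR3_log23 : 3 `^ s0 = 2 :> R.
Proof. by rewrite /powR gt_eqF // divfK ?gt_eqF // lnK // posrE. Qed.

Lemma diam_ge0 U : U !=set0 -> (0 <= diam U)%E.
Proof.
by move=> [y Uy]; apply: ereal_sup_ubound; exists y, y; split=> //; rewrite subrr normr0.
Qed.

Lemma diam_pow_ge0 s U : (0 <= diam_pow s U)%E.
Proof. by rewrite /diam_pow; case: ifP => // _; exact: poweR_ge0. Qed.

Lemma diam_powE s U : U !=set0 -> diam_pow s U = poweR (diam U) s.
Proof. by move=> /set0P/negbTE U0; rewrite /diam_pow U0. Qed.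

Lemma hausdorff_pre_ge0 s delta A : (0 <= hausdorff_pre s delta A)%E.
Proof.
apply: le_ereal_inf_tmp => _ [U [_ _ ->]].
by apply: nneseries_ge0 => n _ _; exact: diam_pow_ge0.
Qed.

Lemma hausdorff_pre_le_measure s delta A : 0 < delta ->
  (hausdorff_pre s delta A <= hausdorff_measure s A)%E.
Proof. by move=> d0; apply: ereal_sup_ubound; exists delta. Qed.

Lemma hausdorff_measure0 s A :
  (forall delta eps : R, 0 < delta -> 0 < eps -> (hausdorff_pre s delta A <= eps%:E)%E) ->
  hausdorff_measure s A = 0%E.
Proof.
move=> H; apply/le_anti/andP; split; last first.
  exact: le_trans (hausdorff_pre_ge0 s 1 A) (hausdorff_pre_le_measure _ _ _).
apply: ge_ereal_sup => _ [delta d0 <-]; apply/lee_addgt0Pr => eps e0.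
by rewrite add0e; exact: H.
Qed.

(** Every exponent [t = s0 + eta] gives measure zero. The contraction estimate is asked only at
    codes of points of [A], because the quotient coding of [Lambda x] is not Lipschitz near the zero
    sequence. *)
Lemma hausdorff_dim_le_log23 A P (M : R) : 0 < M ->
  (forall a, A a -> exists d, a = P d) ->
  (forall n d e, A (P d) -> A (P e) -> (forall i, (i < n)%N -> d i = e i) ->
    `|P d - P e| <= M / 3 ^+ n) ->
  (hausdorff_dim A <= s0%:E)%E.
Proof.
move=> M0 AP PM; have s0_ge0 : 0 <= s0 by rewrite divr_ge0 // ln_ge0; lra.
apply/lee_addgt0Pr => eta eta0; rewrite -EFinD; set t := s0 + eta.
have t0 : 0 < t by rewrite /t; lra.
apply: ereal_inf_lbound; exists t => //; split; first exact: ltW.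
apply: hausdorff_measure0 => delta eps d0 e0.
(* The cover by cylinders costs at most 2^n (M / 3^n)^t = M^t q^n, and [q < 1] since 3^t > 3^s0 =
   2. *)
pose q : R := 2 / 3 `^ t.
have p0 : 0 < 3 `^ t :> R by exact: powR_gt0.
have q0 : 0 < q by rewrite divr_gt0.
have q1 : `|q| < 1.
  rewrite gtr0_norm // ltr_pdivrMr // mul1r -powR3_log23 /powR gt_eqF //.
  by rewrite ltr_expR ltr_pM2r // /t; lra.
have small1 : \forall n \near \oo, geometric M 3^-1 n < delta.
  by apply: (cvgr_lt (0 : R)) => //; apply: cvg_geometric; rewrite ger0_norm; lra.
have small2 : \forall n \near \oo, geometric (M `^ t) q n < eps.
  by apply: (cvgr_lt (0 : R)) => //; exact: cvg_geometric.
have [n [nd ne]] : exists n, geometric M 3^-1 n < delta /\ geometric (M `^ t) q n < eps.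
  near \oo => n; exists n; split; near: n; [exact: small1|exact: small2].
pose U k : set R := [set a | A a /\ exists d, a = P d /\ prefix_code d n = k].
have Mn0 : 0 <= M / 3 ^+ n by rewrite divr_ge0 ?exprn_ge0 // ltW.
have diamU k : (diam (U k) <= (M / 3 ^+ n)%:E)%E.
  apply: ge_ereal_sup => _ [y [z [[Ay [d [yd dk]]] [Az [e [ze ek]]] ->]]].
  rewrite lee_fin yd ze; apply: PM; rewrite -?yd -?ze //.
  by apply: prefix_code_inj; rewrite dk ek.
have powU k : (diam_pow t (U k) <= ((M / 3 ^+ n) `^ t)%:E)%E.
  have [Uk|/set0P Uk] := eqVneq (U k) set0.
    by rewrite /diam_pow Uk eqxx lee_fin powR_ge0.
  rewrite diam_powE //; have := diam_ge0 Uk; have := diamU k.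
  case: (diam (U k)) => [r| |] //=; rewrite !lee_fin => rM r0.
  by rewrite ge0_ler_powR ?nnegrE // ltW.
apply: (@le_trans _ _ (\sum_(0 <= k <oo) diam_pow t (U k))%E).
  apply: ereal_inf_lbound; exists U; split=> //.
  - move=> a Aa; have [d ad] := AP _ Aa; exists (prefix_code d n) => //.
    by split=> //; exists d.
  - move=> k; apply: le_trans (diamU k) _.
    by rewrite lee_fin -exprVn; exact: ltW.
(* Codes of length [n] are below 2^n, so [U k] is empty from there on and the series is a finite
   sum. *)
rewrite (@nneseries_split _ _ 0%N (2 ^ n)%N) => [|k _]; last exact: diam_pow_ge0.
rewrite add0n [X in (_ + X)%E]eseries0 ?adde0 => [|k nk _]; last first.
  rewrite /diam_pow ifT //; apply/eqP/seteqP; split=> // a [_ [d [_ dk]]].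
  by move: (prefix_code_lt d n); rewrite dk ltnNge nk.
apply: le_trans (lee_sum _ (fun k _ => powU k)) _.
rewrite sumEFin lee_fin big_mkord sumr_const card_ord -[_ *+ (2 ^ n)%N]mulr_natr.
apply: le_trans (ltW ne); rewrite /geometric /= powRM ?invr_ge0 ?exprn_ge0 ?(ltW M0) //.
rewrite -mulrA ler_wpM2l ?powR_ge0 // /q expr_div_n natrX mulrC.
rewrite ler_wpM2l ?exprn_ge0 // -powR_inv1 ?exprn_ge0 // powRAC powR_inv1 ?powR_ge0 //.
by rewrite -[X in X `^ t]powR_mulrn // powRAC powR_mulrn ?powR_ge0.
Unshelve. all: by end_near. Qed.

(** A null exponent [t < s0] is contradicted by a positive lower bound on the premeasure at scale 1.
    The range of [P] may be a mere piece of [A], as when [A] is [Lambda x] near a point. *)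
Lemma log23_le_hausdorff_dim A P (c : R) : 0 < c ->
  (forall d, A (P d)) ->
  (forall n d e, (forall i, (i < n)%N -> d i = e i) -> d n != e n ->
    c / 3 ^+ n <= `|P d - P e|) ->
  (s0%:E <= hausdorff_dim A)%E.
Proof.
move=> c0 AP Pc; apply: le_ereal_inf_tmp => _ [t [t0 Ht] <-].
rewrite lee_fin leNgt; apply/negP => ts.
have s0_gt0 : 0 < s0 by exact: le_lt_trans ts.
(* At first difference [n], the binary sums differ by at most 2^-n = K (c / 3^n)^s0. *)
pose K : R := (c `^ s0)^-1.
have K0 : 0 < K by rewrite invr_gt0 powR_gt0.
have holder d e : `|dsum 2 d - dsum 2 e| <= K * `|P d - P e| `^ s0.
  have [de|/existsNP dne] := pselect (forall n, d n = e n).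
    rewrite (_ : d = e); last exact/funext.
    by rewrite subrr normr0 mulr_ge0 ?powR_ge0 // ltW.
  have dneb : exists n, d n != e n by case: dne => n /eqP; exists n.
  case: (ex_minnP dneb) => n dn nmin {dne dneb}.
  have den i : (i < n)%N -> d i = e i.
    by move=> ni; apply/eqP; apply: contraTT ni => /nmin; rewrite -leqNgt.
  apply: (le_trans (dsum_prefix_le _ den)); first lra.
  rewrite [X in X^-1](_ : 2 - 1 = 1) ?invr1 ?mul1r; last lra.
  apply: (@le_trans _ _ (K * (c / 3 ^+ n) `^ s0)); last first.
    rewrite ler_wpM2l ?(ltW K0) // ge0_ler_powR ?nnegrE ?(ltW s0_gt0) //.
      by rewrite divr_ge0 ?exprn_ge0 // ltW.
    exact: Pc.
  rewrite powRM ?invr_ge0 ?exprn_ge0 ?(ltW c0) // mulrA mulVf ?gt_eqF ?powR_gt0 // mul1r.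
  rewrite -[(3 ^+ n)^-1]powR_inv1 ?exprn_ge0 // powRAC powR_inv1 ?powR_ge0 //.
  by rewrite -[X in X `^ s0]powR_mulrn // powRAC powR3_log23 powR_mulrn.
(* Scale 1 suffices: diameters [D <= 1] satisfy D^s0 <= D^t, which turns the Hoelder bound into one
   with exponent [t]. *)
suff : (((2 * K)^-1)%:E <= hausdorff_pre t 1 A)%E.
  move=> /le_trans/(_ (hausdorff_pre_le_measure _ _ ltr01)); rewrite Ht lee_fin.
  by rewrite leNgt invr_gt0 mulr_gt0.
apply: le_ereal_inf_tmp => _ [U [AU U1 ->]].
pose r k := fine (diam_pow t (U k)).
have diamE k : U k !=set0 -> exists D, [/\ 0 <= D, D <= 1 & diam (U k) = D%:E].
  move=> /diam_ge0; have := U1 k; case: (diam (U k)) => // D; rewrite !lee_fin => ? ?.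
  by exists D.
have rE k : diam_pow t (U k) = (r k)%:E.
  rewrite /r; have [Uk|/set0P Uk] := eqVneq (U k) set0; first by rewrite /diam_pow Uk eqxx.
  by rewrite diam_powE //; have [D [_ _ ->]] := diamE _ Uk.
have r0 k : 0 <= r k by rewrite -lee_fin -rE diam_pow_ge0.
(* The centre [m k] is the binary sum of any code whose point lies in [U k]; if there is none, 0
   will do, the condition being vacuous. *)
have /choice[m Hm] : forall k, exists m, forall d, U k (P d) -> `|dsum 2 d - m| <= K * r k.
  move=> k; have [[e Ue]|nU] := pselect (exists e, U k (P e)); last first.
    by exists 0 => d Ud; case: nU; exists d.
  exists (dsum 2 e) => d Ud; apply: le_trans (holder d e) _.
  rewrite ler_wpM2l ?(ltW K0) //.
  have Uk : U k !=set0 by exists (P e).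
  have [D [D0 D1 DE]] := diamE _ Uk.
  have zD : `|P d - P e| <= D.
    by rewrite -lee_fin -DE; apply: ereal_sup_ubound; exists (P d), (P e).
  have -> : r k = D `^ t by rewrite /r diam_powE // DE.
  (* Comparing exponents requires [D > 0], so coinciding points are treated apart. *)
  have [->|z0] := eqVneq `|P d - P e| 0; first by rewrite powR0 ?powR_ge0 // gt_eqF.
  have Dgt0 : 0 < D by apply: lt_le_trans zD; rewrite lt_def z0 normr_ge0.
  apply: (@le_trans _ _ (D `^ s0)).
    by rewrite ge0_ler_powR ?nnegrE // ltW.
  by apply: ger_powR; [rewrite Dgt0 | exact: ltW].
have cover : `[0, 1]%classic `<=` \bigcup_k `[m k - K * r k, m k + K * r k]%classic.
  move=> y /=; rewrite in_itv /= => /dsum2_surj[d ->].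
  have [k _ Uk] := AU _ (AP d); exists k => //=.
  by have := Hm _ _ Uk; rewrite in_itv /= ler_distl.
have subadd : (lebesgue_measure (`[0%R, 1%R]%classic : set R) <=
    \sum_(0 <= k <oo) lebesgue_measure (`[(m k - K * r k)%R, (m k + K * r k)%R]%classic : set R))%E.
  by apply: measure_sigma_subadditive.
(* The intervals have length [2 * K * r k] and cover [0, 1], so subadditivity of Lebesgue measure
   gives this. *)
suff : (1 <= \sum_(0 <= k <oo) ((2 * K)%:E * diam_pow t (U k)))%E.
  rewrite nneseriesZl => [|k _]; last exact: diam_pow_ge0.
  move=> H1; rewrite -[leLHS]mule1 lee_pdivrMl //; exact: mulr_gt0.
move: subadd; rewrite lebesgue_measure_itv /= lte_fin ltr01 sube0 => /le_trans; apply.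
apply: lee_nneseries => // k _.
rewrite lebesgue_measure_itv /= lte_fin; case: ifP => _.
  by rewrite rE -EFinB -EFinM lee_fin; lra.
by rewrite rE -EFinM lee_fin !mulr_ge0 // ltW.
Qed.

End DimensionBounds.

(** * Dimensions of [Elam lam] and of [Lambda x] near a point *)

Section CantorSets.
Context {R : realType}.
Implicit Types (x lam : R) (d e : nat -> bool).

Local Notation s0 := (ln 2 / ln 3 : R).

Let three_gt1 : 1 < 3 :> R.
Proof. lra. Qed.

Lemma ElamP lam t : Elam lam t <-> exists d, t = lam * dsum 3 d.
Proof.
have cvgd d : series (fun i => (if d i then lam else 0) / 3 ^+ i.+1) @ \oo -->
    lam * dsum 3 d.
  rewrite (_ : series _ = fun n => lam * series (fun i => (d i)%:R / 3 ^+ i.+1) n).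
    by apply: cvgM; [exact: cvg_cst | exact: cvg_dsum].
  apply/funext => n; rewrite /series /= mulr_sumr; apply: eq_bigr => i _.
  by case: (d i); rewrite ?mulr1 ?mul0r ?mul1r ?mulr0.
rewrite Elam_digits; split=> [[d dt]|[d ->]]; exists d; last exact: cvgd.
exact: (cvg_unique (@Rhausdorff R) dt (cvgd d)).
Qed.

Lemma LambdaP x lam : 0 < x ->
  Lambda x lam <-> exists d, 0 < dsum 3 d :> R /\ lam = x / dsum 3 d.
Proof.
move=> x0; split=> [[l0 /ElamP[d xd]]|[d [d0 ->]]].
  have d0 : 0 < dsum 3 d :> R by rewrite -(pmulr_rgt0 _ l0) -xd.
  by exists d; split=> //; rewrite xd mulfK // gt_eqF.
split; first exact: divr_gt0.
by apply/ElamP; exists d; rewrite divfK // gt_eqF.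
Qed.

Lemma hausdorff_dim_Elam lam : 0 < lam -> hausdorff_dim (Elam lam) = s0%:E.
Proof.
move=> l0; apply/le_anti/andP; split.
  apply: (@hausdorff_dim_le_log23 _ _ (fun d => lam * dsum 3 d) (lam * (3 - 1)^-1)).
  - by rewrite mulr_gt0 // invr_gt0; lra.
  - by move=> a /ElamP.
  - move=> n d e _ _ de; rewrite -mulrBr normrM gtr0_norm // -mulrA ler_pM2l //.
    exact: dsum_prefix_le.
apply: (@log23_le_hausdorff_dim _ _ (fun d => lam * dsum 3 d) (lam / 6)).
- by rewrite divr_gt0.
- by move=> d; apply/ElamP; exists d.
- move=> n d e de dn; rewrite -mulrBr normrM gtr0_norm // -mulrA ler_pM2l //.
  exact: dsum3_prefix_ge.
Qed.

(** The Lipschitz factor is expressed through the images [x / a] and [x / b], because the interval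
    around [lam] bounds these directly. *)
Let inv_dist x a b : 0 < x -> 0 < a -> 0 < b ->
  `|x / a - x / b| = (x / a) * (x / b) / x * `|a - b|.
Proof.
move=> x0 a0 b0; have k0 : 0 < (x / a) * (x / b) / x by rewrite !(divr_gt0, mulr_gt0).
rewrite -{1}(gtr0_norm k0) -normrM -normrN; congr `|_|.
by field; rewrite !gt_eqF.
Qed.

(** Parametrises the cylinder of length [N] around [d] by free tails [e]. *)
Definition splice (N : nat) d e : nat -> bool :=
  fun i => if (i < N)%N then d i else e (i - N)%N.

(** Above, images below [lam + delta] bound the Lipschitz factor by (lam + delta)^2 / x. Below, a
    long enough cylinder around a code of [lam] is mapped into the interval. *)
Lemma hausdorff_dim_Lambda x lam delta : 0 < x -> Lambda x lam ->
  0 < delta -> delta < lam ->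
  hausdorff_dim (Lambda x `&` `]lam - delta, lam + delta[) = s0%:E.
Proof.
move=> x0 /(LambdaP _ x0)[d0 [a0 lamE]] delta0 ltdelta.
set a := dsum 3 d0 in a0 lamE.
have l0 : 0 < lam by rewrite lamE divr_gt0.
have M0 : 0 < (lam + delta) ^+ 2 / x by rewrite divr_gt0 // exprn_gt0 // addr_gt0.
apply/le_anti/andP; split.
  apply: (@hausdorff_dim_le_log23 _ _ (fun d => x / dsum 3 d)
    ((lam + delta) ^+ 2 / x * (3 - 1)^-1)).
  - by rewrite mulr_gt0 // invr_gt0; lra.
  - by move=> b [/(LambdaP _ x0)[d [_ ->]] _]; exists d.
  (* Since [x / 0 = 0] here, a positive quotient excludes the zero sum. *)
  - have pos d : Lambda x (x / dsum 3 d) -> 0 < dsum 3 d :> R.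
      by case=> + _; rewrite pmulr_rgt0 // invr_gt0.
    move=> n d e [/pos d_gt0 /=]; rewrite in_itv /= => /andP[_ d1].
    move=> [/pos e_gt0 /=]; rewrite in_itv /= => /andP[_ e1] de.
    rewrite inv_dist // -[leRHS]mulrA; apply: ler_pM; rewrite ?normr_ge0 //.
    + by rewrite !(divr_ge0, mulr_ge0) // ltW.
    + rewrite ler_pM2r ?invr_gt0 // expr2; apply: ler_pM; rewrite ?divr_ge0 ?ltW //.
    + exact: dsum_prefix_le.
(* Sums within [eta] of [a] have quotients in the open interval around [lam]; [N] is then chosen so
   that all tails after [N] digits move the sum by less than [eta]. *)
pose eta := Num.min (a - x / (lam + delta)) (x / (lam - delta) - a).
have aE : a = x / lam by rewrite lamE invf_div mulrC divfK ?gt_eqF.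
have ld0 : 0 < lam - delta by rewrite subr_gt0.
have ld1 : 0 < lam + delta by rewrite addr_gt0.
have eta0 : 0 < eta.
  rewrite /eta lt_min !subr_gt0 aE !ltr_pM2l // !ltf_pV2 ?posrE //.
  by apply/andP; split; lra.
have [N HN] : exists N, geometric ((3 - 1)^-1) 3^-1 N < eta.
  have : \forall n \near \oo, geometric ((3 - 1)^-1) 3^-1 n < eta.
    by apply: (cvgr_lt (0 : R)) => //; apply: cvg_geometric; rewrite ger0_norm; lra.
  by move=> near_eta; near \oo => N; exists N; near: N.
have near_a e : `|dsum 3 (splice N d0 e) - a| < eta.
  apply: le_lt_trans HN; rewrite /geometric /= exprVn; apply: dsum_prefix_le => //.
  by move=> i iN; rewrite /splice iN.
have itv_a e : x / (lam + delta) < dsum 3 (splice N d0 e) < x / (lam - delta).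
  have := near_a e; rewrite ltr_norml /eta => /andP[].
  rewrite ltrNl !lt_min => /andP[? _] /andP[_ ?].
  by apply/andP; split; lra.
have pos e : 0 < dsum 3 (splice N d0 e) :> R.
  by have /andP[/(lt_trans _)-> //] := itv_a e; rewrite divr_gt0.
(* The spliced sequences first differ at [N + n], whence 6^-1 / 3^N; the factor [x] bounds the
   inverse Lipschitz factor x / (u v) from below, as u, v <= 1/2. *)
apply: (@log23_le_hausdorff_dim _ _ (fun d => x / dsum 3 (splice N d0 d))
  (x * (6^-1 / 3 ^+ N))).
- by rewrite mulr_gt0 // divr_gt0 // exprn_gt0.
- move=> e; split; first by apply/LambdaP => //; exists (splice N d0 e).
  have /andP[e1 e2] := itv_a e; rewrite /= in_itv /= ltr_pdivlMr // ltr_pdivrMr //.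
  move: e1 e2; rewrite ltr_pdivrMr // ltr_pdivlMr // mulrC.
  by rewrite [X in _ -> X < _ -> _]mulrC => -> ->.
- move=> n d e de dn; rewrite inv_dist //.
  have := @dsum3_prefix_ge R (splice N d0 d) (splice N d0 e) (N + n).
  rewrite /splice ltnNge leq_addr /= addKn => /(_ _ dn) H.
  rewrite -[leLHS]mulrA; apply: ler_pM; rewrite ?(ltW x0) //.
  + set u := dsum _ _; set v := dsum _ _.
    have u0 : 0 < u by exact: pos.
    have v0 : 0 < v by exact: pos.
    have u1 : u <= 1 / 2 by exact: dsum3_le.
    have v1 : v <= 1 / 2 by exact: dsum3_le.
    rewrite ler_pdivlMr // mulf_div ler_pdivlMr ?mulr_gt0 // ler_piMr ?mulr_ge0 ?(ltW x0) //.
    by rewrite mulr_ile1 ?(ltW u0) ?(ltW v0) //; lra.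
  + rewrite -mulrA -invfM -exprD; apply: H => i iNn; case: ifP => // /negbT.
    by rewrite -leqNgt => Ni; apply: de; rewrite ltn_subLR.
Unshelve. all: by end_near. Qed.

End CantorSets.

Theorem theorem1p2 (R : realType) (x : R) (hx : 0 < x)
    (lam : R) (hlam : Lambda x lam)
    (delta : R) (hdelta0 : 0 < delta) (hdelta : delta < lam) :
  hausdorff_dim (Lambda x `&` `]lam - delta, lam + delta[%classic)
    = hausdorff_dim (Elam lam)
  /\ hausdorff_dim (Elam lam) = (ln 2 / ln 3)%:E.
Proof.
have Elam_dim := hausdorff_dim_Elam (proj1 hlam).
by split=> //; rewrite Elam_dim; exact: hausdorff_dim_Lambda.
Qed.
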